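(* Let $\nu$ be a (Borel) probability measure on $[0,1]$ and let $1\le n<\infty$ be an integer. Let $G_n$ be the random graph on $\{1,\dots,n\}$ constructed from the i.i.d. sequence $(\theta_j)_{j\ge1}$ with distribution $\nu$ (as defined in the context), and let $G(n,W)$ be the random graph on $\{1,\dots,n\}$ defined by the kernel $W:([0,1]^2)^2\to[0,1]$, $$W\bigl((s_1,t_1),(s_2,t_2)\bigr)=\begin{cases}s_2,& t_1<t_2,\\ s_1,& t_1>t_2,\\ 0,& t_1=t_2,\end{cases}$$ on the probability space $([0,1]^2,\mu_\nu)$, where $\mu_\nu=\nu\times\lambda$ and $\lambda$ is Lebesgue measure on $[0,1]$. Then $G_n$ and $G(n,W)$, regarded as unlabelled graphs, have the same distribution.
   Context: All graphs are simple and undirected. The random graph $G_n$: let $\theta_1,\theta_2,\dots$ be an i.i.d. sequence of random variables with distribution $\nu$. Conditionally given this sequence, let $G_\infty$ be the infinite random graph with vertex set $\{1,2,3,\dots\}$ in which, for each pair $i\ne j$, the edge $\{i,j\}$ appears with probability $\theta_{\max\{i,j\}}$, all edges appearing independently (conditionally on $(\theta_j)_{j\ge1}$). Then $G_n$ is the subgraph of $G_\infty$ induced on $\{1,\dots,n\}$. Kernel and the random graph $G(n,W)$: a kernel on a probability space $(S,\mu)$ is a symmetric measurable function $W:S^2\to[0,1]$. Given such $W$, $G(n,W)$ is the random graph with vertex set $\{1,\dots,n\}$ obtained by taking i.i.d. random points $X_1,\dots,X_n$ in $S$ with distribution $\mu$ and then, conditionally on $(X_i)_i$, letting $\{i,j\}$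 be an edge with probability $W(X_i,X_j)$, independently for all pairs $i<j$. (The value of the kernel in the claim on the null set $t_1=t_2$ is immaterial.) ''Have the same distribution as unlabelled graphs'' means that the isomorphism classes of the two random graphs have the same distribution, i.e. for every graph $H$ on $n$ vertices, $\mathbb P(G_n\cong H)=\mathbb P(G(n,W)\cong H)$. *)

(* Defs.v *)
From HB Require Import structures.
From mathcomp Require Import all_boot all_order all_algebra.
From mathcomp Require Import interval_inference.
From mathcomp Require Import all_classical all_reals all_analysis.
From mathcomp Require Import measurable_realfun.

Set Implicit Arguments.
Unset Strict Implicit.
Unset Printing Implicit Defensive.

Import Order.TTheory GRing.Theory Num.Theory.

Local Open Scope classical_set_scope.
Local Open Scope ring_scope.

Definition zero01 (R : realType) : {i01 R} := 0%:i01.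

HB.instance Definition _ (R : realType) := isPointed.Build {i01 R} (zero01 R).

Definition val01 (R : realType) (x : {i01 R}) : R := x%:num.

(* The measurable sets of [I01 R] are the traces on [0, 1] of the Borel sets. *)
Definition I01 (R : realType) : Type := g_sigma_algebra_preimageType (@val01 R).

HB.instance Definition _ (R : realType) := Measurable.on (I01 R).

Section lebesgue01.
Context (R : realType).

Definition lebesgue01 (A : set (I01 R)) : \bar R :=
  lebesgue_measure (@val01 R @` A).

Lemma val01_image_preimage (B : set R) :
  @val01 R @` (@val01 R @^-1` B) = `[0, 1]%classic `&` B.
Proof.
apply/seteqP; split => [_ [x Bx <-]|x [x01 Bx]].
  by split => //=; rewrite in_itv/= /val01 ge0 le1.
move: x01; rewrite /= in_itv/= => /andP[x0 x1].
by exists (Itv01 x0 x1).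
Qed.

Lemma measurable_val01_image (A : set (I01 R)) :
  measurable A -> measurable (@val01 R @` A).
Proof.
move=> [B mB <-]; rewrite setTI val01_image_preimage.
by apply: measurableI.
Qed.

Let lebesgue010 : lebesgue01 set0 = 0%E.
Proof. by rewrite /lebesgue01 image_set0 measure0. Qed.

Let lebesgue01_ge0 A : (0 <= lebesgue01 A)%E.
Proof. exact: measure_ge0. Qed.

Let lebesgue01_sigma_additive : semi_sigma_additive lebesgue01.
Proof.
move=> F mF tF mUF; rewrite /lebesgue01 image_bigcup.
apply: measure_semi_sigma_additive.
- by move=> i; exact: measurable_val01_image.
- apply/trivIsetP => i j _ _ ij; rewrite -subset0 => _ [[x Fx <-] [y Fy]].
  move=> /val_inj yx; move: Fy; rewrite yx => Fy.
  have /trivIsetP/(_ i j Logic.I Logic.I ij) FiFj := tF.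
  by have : (F i `&` F j) x by []; rewrite FiFj.
- by rewrite -image_bigcup; exact: measurable_val01_image.
Qed.

HB.instance Definition _ := isMeasure.Build _ _ _ lebesgue01
  lebesgue010 lebesgue01_ge0 lebesgue01_sigma_additive.

Let lebesgue01_setT : lebesgue01 [set: _] = 1%E.
Proof.
rewrite /lebesgue01 -(preimage_setT (@val01 R)) val01_image_preimage setIT.
by rewrite lebesgue_measure_itv/= lte01 oppr0 adde0.
Qed.

HB.instance Definition _ := Measure_isProbability.Build _ _ _ lebesgue01
  lebesgue01_setT.

End lebesgue01.

Record sgraph (V : Type) := SGraph {
  adj : V -> V -> bool ;
  adj_sym : forall x y, adj x y = adj y x ;
  adj_irrefl : forall x, adj x x = false }.

Definition graph_iso (V V' : Type) (G : sgraph V) (H : sgraph V') : Prop :=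
  exists2 f : V -> V', bijective f &
    forall x y, adj G x y = adj H (f x) (f y).

(* Vertices are numbered from 0, so that the vertices of [G_n] are those of
   ['I_n]. *)
Definition initial_subgraph (n : nat) (G : sgraph nat) : sgraph 'I_n :=
  @SGraph 'I_n (fun i j => adj G i j)
    (fun i j => adj_sym G i j) (fun i => adj_irrefl G i).

Section probability_notions.
Context d (T : measurableType d) (R : realType) (P : probability T R).

Definition mutually_independent (I : eqType) d' (S : measurableType d')
    (X : I -> {RV P >-> S}) : Prop :=
  forall (J : seq I) (B : I -> set S), uniq J ->
    (forall i, i \in J -> measurable (B i)) ->
    P [set w | forall i, i \in J -> B i (X i w)] =
    (\prod_(i <- J) P (X i @^-1` B i))%E.

(* The values of a measure on non-measurable sets are irrelevant, so equality
   of laws is restricted to measurable sets. *)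
Definition iid_with_law (I : eqType) d' (S : measurableType d')
    (mu : probability S R) (X : I -> {RV P >-> S}) : Prop :=
  mutually_independent X /\
  forall i (B : set S), measurable B -> distribution P (X i) B = mu B.

Definition sigma_family (I : Type) d' (S : measurableType d')
    (X : I -> T -> S) : set (set T) :=
  <<s [set A | exists i (B : set S), measurable B /\ A = X i @^-1` B] >>.

Definition cond_prob_version (F : set (set T)) (A : set T) (q : T -> R) :=
  [/\ forall B : set R, measurable B -> F (q @^-1` B),
      P.-integrable setT (EFin \o q) &
      forall C, F C -> P (A `&` C) = (\int[P]_(w in C) (q w)%:E)%E].

Definition random_graph (V : Type) (G : T -> sgraph V) : Prop :=
  forall x y, measurable [set w | adj (G w) x y].

(* The edge [{x, y}] is represented by the pair [(x, y)] with [x < y].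
   Conditional independence given [F] is the product rule for every finite set
   [J] of edges; singletons [J] say that [p x y] is the conditional probability
   of the edge [{x, y}]. *)
Definition cond_indep_edges d' (V : orderType d') (F : set (set T))
    (G : T -> sgraph V) (p : V -> V -> T -> R) : Prop :=
  forall J : seq (V * V), uniq J ->
    (forall e, e \in J -> (e.1 < e.2)%O) ->
    cond_prob_version F [set w | forall e, e \in J -> adj (G w) e.1 e.2]
      (fun w => \prod_(e <- J) p e.1 e.2 w).

Definition is_G_infty (nu : probability (I01 R) R)
    (theta : nat -> {RV P >-> I01 R}) (G : T -> sgraph nat) : Prop :=
  [/\ iid_with_law nu theta, random_graph G &
      cond_indep_edges (sigma_family theta) G
        (fun i j w => val01 (theta (maxn i j) w))].

End probability_notions.

Arguments mutually_independent {d T R} P {I d' S}.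
Arguments iid_with_law {d T R} P {I d' S}.
Arguments cond_prob_version {d T R}.
Arguments cond_indep_edges {d T R} P {d' V}.
Arguments is_G_infty {d T R}.

Record graph_kernel (R : realType) d (S : measurableType d) := GraphKernel {
  kernel_fun : S * S -> I01 R ;
  kernel_sym : forall x y, kernel_fun (x, y) = kernel_fun (y, x) ;
  kernel_measurable : measurable_fun setT kernel_fun }.

Definition is_G_kernel d (T : measurableType d) (R : realType)
    (P : probability T R) d' (S : measurableType d') (mu : probability S R)
    (W : graph_kernel R S) (n : nat) (X : 'I_n -> {RV P >-> S})
    (G : T -> sgraph 'I_n) : Prop :=
  [/\ iid_with_law P mu X, random_graph G &
      cond_indep_edges P (sigma_family X) G
        (fun i j w => val01 (kernel_fun W (X i w, X j w)))].

Arguments is_G_kernel {d T R} P {d' S} mu W {n}.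

Section the_kernel.
Context (R : realType).

Definition later_mark (z : (I01 R * I01 R) * (I01 R * I01 R)) : I01 R :=
  let: ((s1, t1), (s2, t2)) := z in
  if val01 t1 < val01 t2 then s2
  else if val01 t2 < val01 t1 then s1 else zero01 R.

Lemma later_mark_sym x y : later_mark (x, y) = later_mark (y, x).
Proof.
by case: x y => [s1 t1] [s2 t2] /=; case: ltgtP.
Qed.

Lemma measurable_val01 : measurable_fun setT (@val01 R : I01 R -> R).
Proof. by move=> _ B mB; exists B. Qed.

Lemma later_mark_measurable : measurable_fun setT later_mark.
Proof.
rewrite (_ : later_mark = fun z =>
  if val01 z.1.2 < val01 z.2.2 then z.2.1
  else if val01 z.2.2 < val01 z.1.2 then z.1.1 else zero01 R); last first.
  by apply/funext => -[[s1 t1] [s2 t2]].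
have m1 : measurable_fun setT (fun z : (I01 R * I01 R) * (I01 R * I01 R) =>
    val01 z.1.2).
  apply: (measurableT_comp measurable_val01).
  exact: (measurableT_comp measurable_snd measurable_fst).
have m2 : measurable_fun setT (fun z : (I01 R * I01 R) * (I01 R * I01 R) =>
    val01 z.2.2).
  apply: (measurableT_comp measurable_val01).
  exact: (measurableT_comp measurable_snd measurable_snd).
apply: measurable_fun_ifT; first exact: measurable_fun_ltr.
  exact: (measurableT_comp measurable_fst measurable_snd).
apply: measurable_fun_ifT; first exact: measurable_fun_ltr.
  exact: (measurableT_comp measurable_fst measurable_fst).
exact: measurable_cst.
Qed.

Definition later_kernel : graph_kernel R (I01 R * I01 R)%type :=
  GraphKernel later_mark_sym later_mark_measurable.

Definition mu_nu (nu : probability (I01 R) R) :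
    probability (I01 R * I01 R)%type R :=
  (nu \x lebesgue01 (R:=R))%E.

End the_kernel.

Definition same_unlabelled_law (R : realType) d (T : measurableType d)
    (P : probability T R) d' (T' : measurableType d') (P' : probability T' R)
    (n : nat) (G : T -> sgraph 'I_n) (G' : T' -> sgraph 'I_n) : Prop :=
  forall H : sgraph 'I_n,
    P [set w | graph_iso (G w) H] = P' [set w | graph_iso (G' w) H].

(* Main.v *)
From HB Require Import structures.
Require Import Defs.
From mathcomp Require Import all_boot all_order all_algebra.
From mathcomp Require Import interval_inference.
From mathcomp Require Import all_classical all_reals all_analysis.
From mathcomp Require Import measurable_realfun perm.

Set Implicit Arguments.
Unset Strict Implicit.
Unset Printing Implicit Defensive.

Import Order.TTheory GRing.Theory Num.Theory.

Local Open Scope classical_set_scope.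
Local Open Scope ring_scope.

(** Write X_i = (s_i, t_i): the vertex i of G(n, W) carries a mark s_i with law
    nu and a uniform arrival time t_i. Almost surely the times are distinct, so
    exactly one permutation sigma of the vertices makes i |-> t_(sigma i)
    increasing. If the vertices are renamed in order of arrival, then, since W
    picks the mark of the later of two vertices, i < j are joined with
    probability equal to the mark of the j-th arrival. The marks are independent
    of the times, hence still i.i.d. with law nu once the order of arrival is
    known: the renamed graph is a copy of G_n, whatever that order.

    The proof makes this precise without conditioning on null events. Let
    A_sigma be the event that i |-> t_(sigma i) is increasing. For a fixed graph
    H it is shown that

      P' (G(n, W) ~ H and A_sigma) = P (G_n ~ H) * P' A_sigma,

    and summing over sigma gives the theorem, because the A_sigma are disjoint
    and cover everything but the null set where two times coincide
    ([sum_over_time_orders]). Only the identity permutation has to be treated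
    ([graph_iso_given_increasing]): relabelling the vertices by sigma turns
    G(n, W) into another graph built from the same kernel, with points
    X_(sigma i) ([is_G_kernel_relabel]), and does not change its isomorphism
    class.

    For the identity, a formula P' (f' in B and D) = P (f in B) * P' D, where f
    and f' are corresponding random objects, has to be extended three times from
    a class of simple sets B to the sigma-algebra that it generates. The first
    two extensions, for vectors of times and then of marks, start from
    rectangles and give [marks_independent_of_times]. The third, for the graphs,
    starts from the events that given edges are present. All three are instances
    of one Dynkin class argument, [law_given_event_unique]. The probability that
    given edges are present is an integral of a product of marks, and
    [integral_given_event] carries it from one model to the other. *)

(** * Transferring a law between two probability spaces *)

Section independence_of_an_event.
Context d (T : measurableType d) d' (T' : measurableType d') (R : realType).
Variables (P : probability T R) (P' : probability T' R).

(** The formula says that, under P', f' is independent of D and has the law that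
    f has under P. The sets B for which it holds form a Dynkin class, so it is
    enough to check it on a pi-system. No sigma-algebra is fixed on U: the
    lemma serves vectors of marks, vectors of times and graphs alike. *)
Lemma law_given_event_unique (U : Type) (G : set (set U)) (f : T -> U)
    (f' : T' -> U) (D : set T') :
  setI_closed G -> measurable D ->
  (forall B, G B -> measurable (f @^-1` B)) ->
  (forall B, G B -> measurable (f' @^-1` B)) ->
  (forall B, G B -> P' (f' @^-1` B `&` D) = (P (f @^-1` B) * P' D)%E) ->
  forall B, <<s G >> B -> P' (f' @^-1` B `&` D) = (P (f @^-1` B) * P' D)%E.
Proof.
move=> GI mD mf mf' GE.
pose K := [set B | [/\ measurable (f @^-1` B), measurable (f' @^-1` B) &
  P' (f' @^-1` B `&` D) = (P (f @^-1` B) * P' D)%E]].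
suff: <<s G >> `<=` K by move=> sK B /sK[].
rewrite -setI_closed_g_dynkin_g_sigma_algebra//.
apply: smallest_sub => [|B GB]; last by split; [exact: mf|exact: mf'|exact: GE].
split.
- by split; rewrite ?preimage_setT// setTI probability_setT mul1e.
- move=> B [mB mB' BE].
  split.
  + rewrite preimage_setC.
    exact: measurableC.
  + rewrite preimage_setC.
    exact: measurableC.
  have -> : f' @^-1` (~` B) = ~` (f' @^-1` B) by [].
  have -> : f @^-1` (~` B) = ~` (f @^-1` B) by [].
  transitivity (P' D - P' (f' @^-1` B `&` D))%E.
    rewrite setIC -setDE measureD//; first by rewrite (setIC D).
    by rewrite (le_lt_trans (probability_le1 _ _))// ltry.
  rewrite BE probability_setC// muleBl ?fin_num_measure ?mul1e//.
- move=> F tF KF; have mF i : measurable (f @^-1` F i) by case: (KF i).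
  have mF' i : measurable (f' @^-1` F i) by case: (KF i).
  split; rewrite ?preimage_bigcup.
  + exact: bigcup_measurable.
  + exact: bigcup_measurable.
  rewrite setI_bigcupl.
  rewrite measure_bigcup//=; last 2 first.
  - by move=> i _; exact: measurableI.
  - apply/trivIsetP => i j _ _ ij; rewrite setIACA -preimage_setI.
    by have /trivIsetP -> := tF => //; rewrite preimage_set0 set0I.
  rewrite (measure_bigcup P)//=; last first.
    apply/trivIsetP => i j _ _ ij; rewrite -preimage_setI.
    by have /trivIsetP -> := tF => //; rewrite preimage_set0.
  have Dfin : P' D \is a fin_num by rewrite fin_num_measure.
  rewrite muleC -(fineK Dfin) -nneseriesZl//.
  by apply: eq_eseriesr => i _; case: (KF i) => _ _ ->; rewrite fineK// muleC.
Qed.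

(** Both sides integrate h against measures on U: the image by f' of P'
    restricted to D, and the image of P by f scaled by P' D. The hypothesis says
    that these two measures coincide. *)
Lemma integral_given_event d0 (U : measurableType d0) (f : T -> U)
    (f' : T' -> U) (D : set T') (h : U -> R) :
  measurable_fun setT f -> measurable_fun setT f' -> measurable D ->
  measurable_fun setT h -> (forall x, 0 <= h x) ->
  (forall B, measurable B ->
    P' (f' @^-1` B `&` D) = (P (f @^-1` B) * P' D)%E) ->
  (\int[P']_(w in D) (h (f' w))%:E = (\int[P]_w (h (f w))%:E) * P' D)%E.
Proof.
move=> mf mf' mD mh h0 fE.
have mEh : measurable_fun setT (EFin \o h) by exact/measurable_EFinP.
have mEh' : measurable_fun setT (EFin \o h \o f') by exact: measurableT_comp.
pose mu := mrestr P' mD.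
transitivity (\int[mu]_(w in D) (h (f' w))%:E)%E.
  by apply: eq_measure_integral => A mA AD; rewrite /mu /= /mrestr setIidl.
transitivity (\int[mu]_w (h (f' w))%:E)%E.
  rewrite -(setTI D) -[D in LHS]setCK -setDE.
  apply/esym; apply: ge0_negligible_integral => //.
  - exact: measurableC.
  - by move=> x _; rewrite lee_fin.
  - by rewrite /mu /= /mrestr setICl measure0.
pose F : {mfun T >-> U} := HB.pack f (isMeasurableFun.Build _ _ _ _ _ mf).
pose F' : {mfun T' >-> U} := HB.pack f' (isMeasurableFun.Build _ _ _ _ _ mf').
have Eh0 : {in setT, forall x, 0 <= (h x)%:E}%E by move=> x _; rewrite lee_fin.
transitivity (\int[pushforward mu F']_y (h y)%:E)%E.
  rewrite (ge0_integral_pushforward mf' mu measurableT mEh Eh0).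
  by rewrite preimage_setT.
pose k := NngNum (fine_ge0 (measure_ge0 P' D)).
transitivity (\int[mscale k (distribution P F)]_y (h y)%:E)%E.
  apply: eq_measure_integral => A mA _.
  rewrite /= /mscale /distribution /pushforward /= /mrestr.
  by rewrite fE// fineK ?fin_num_measure// muleC.
rewrite ge0_integral_mscale//=; last by move=> x _; rewrite lee_fin.
rewrite (ge0_integral_pushforward mf P measurableT mEh Eh0) preimage_setT.
by rewrite fineK ?fin_num_measure// muleC.
Qed.

End independence_of_an_event.

(** * Finite families of random variables *)

(** The generators of the product sigma-algebra on a finite power of S; they
    form a pi-system. *)
Definition rectangles (I : Type) d (S : measurableType d) :
    set (set (I -> S)) :=
  [set [set x | forall i, B i (x i)] |
    B in [set B | forall i, measurable (B i)]].

Section product_sigma_algebra.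
Context (I : finType) d (S : measurableType d).

Lemma rectangles_setI : setI_closed (@rectangles I d S).
Proof.
move=> _ _ [A mA <-] [B mB <-]; exists (fun i => A i `&` B i).
  by move=> i; exact: measurableI.
apply/seteqP; split => x /=; first by move=> ABx; split => i; case: (ABx i).
by move=> [Ax Bx] i.
Qed.

Lemma measurable_coordinate (i : I) :
  measurable_fun setT (fun x : g_sigma_algebraType (@rectangles I d S) => x i).
Proof.
move=> _ B mB; rewrite setTI; apply: sub_sigma_algebra.
exists (fun j => if j == i then B else setT).
  by move=> j; case: ifP.
apply/seteqP; split => x /=; first by move/(_ i); rewrite eqxx.
by move=> Bx j; case: eqP => // ->.
Qed.

Lemma measurable_to_product d0 (T : measurableType d0) (X : T -> I -> S) :
  (forall i, measurable_fun setT (fun w => X w i)) ->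
  @measurable_fun _ _ T (g_sigma_algebraType (@rectangles I d S)) setT X.
Proof.
move=> mX; apply: (@measurability _ _ T
  (g_sigma_algebraType (@rectangles I d S)) _ _ (@rectangles I d S)) => //.
move=> _ [_ [B mB <-] <-]; rewrite setTI.
rewrite (_ : _ @^-1` _ =
    \bigcap_(i in [set: I]) ((X ^~ i) @^-1` B i)); last first.
  by apply/seteqP; split => w /= Bw i; [move=> _; exact: Bw|exact: Bw].
apply: fin_bigcap_measurable => [|i _]; first exact: finite_finset.
by rewrite -[X in measurable X]setTI; exact: mX.
Qed.

End product_sigma_algebra.

Section iid_families.
Context d (T : measurableType d) (R : realType) (P : probability T R).
Context d' (S : measurableType d').

Lemma iid_reindex (I J : eqType) (mu : probability S R) (X : J -> {RV P >-> S})
    (f : I -> J) : injective f ->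
  iid_with_law P mu X -> iid_with_law P mu (fun i => X (f i)).
Proof.
move=> f_inj [indX lawX]; split; last by move=> i; exact: lawX.
move=> s B us mB.
(* C transports B along f: since f is injective, C (f i) = B i. *)
pose C (j : J) := \bigcap_(i in [set i | i \in s /\ f i = j]) B i.
have CE i : i \in s -> C (f i) = B i.
  move=> si; apply/seteqP; split => x; first by apply.
  by move=> Bx k [_ /f_inj ->].
have := indX (map f s) C; rewrite map_inj_uniq// big_map => /(_ us).
under eq_big_seq => i si do rewrite CE//.
move=> <-; last by move=> _ /mapP[i si ->]; rewrite CE//; exact: mB.
congr (P _); apply/seteqP; split => w /= Bw.
  by move=> _ /mapP[i si ->]; rewrite CE//; exact: Bw.
by move=> i si; rewrite -CE//; apply: Bw; exact: map_f.
Qed.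

Lemma iid_rectangle (I : finType) (mu : probability S R) (X : I -> {RV P >-> S})
    (B : I -> set S) : iid_with_law P mu X -> (forall i, measurable (B i)) ->
  P [set w | forall i, B i (X i w)] = (\prod_i mu (B i))%E.
Proof.
move=> [indX lawX] mB.
have := indX (index_enum I) B (index_enum_uniq I) (fun i _ => mB i).
rewrite (eq_bigr (fun i => mu (B i))); last by move=> i _; exact: lawX.
move=> <-; congr (P _).
apply/seteqP; split => w /= Bw i; first by move=> _; exact: Bw.
exact/Bw/mem_index_enum.
Qed.

End iid_families.

(** * Random graphs on a finite vertex set *)

(* A measurable type has a point and a choice operator; these make graphs the
   carrier of one, whose sigma-algebra is generated below. *)
HB.instance Definition _ (n : nat) := gen_eqMixin (sgraph 'I_n).
HB.instance Definition _ (n : nat) := gen_choiceMixin (sgraph 'I_n).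
HB.instance Definition _ (n : nat) := isPointed.Build (sgraph 'I_n)
  (@SGraph 'I_n (fun _ _ => false) (fun _ _ => erefl) (fun _ => erefl)).

Section edge_events.
Variable n : nat.

(** The events whose conditional probabilities the two models prescribe. They
    only say that edges are present, never absent, but they form a pi-system
    that generates all events about the graph, so that their probabilities
    determine those of the isomorphism classes. *)
Definition edge_events : set (set (sgraph 'I_n)) :=
  [set [set G | forall e, e \in J -> adj G e.1 e.2] | J in
    [set J : seq ('I_n * 'I_n) | uniq J /\ forall e, e \in J -> (e.1 < e.2)%N]].

Lemma edge_events_setI : setI_closed edge_events.
Proof.
move=> _ _ [J [_ ltJ] <-] [K [_ ltK] <-]; exists (undup (J ++ K)).
  split=> [|e]; first exact: undup_uniq.
  by rewrite mem_undup mem_cat => /orP[/ltJ|/ltK].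
apply/seteqP; split => G /=.
  by move=> GJK; split => e eJ; apply: GJK; rewrite mem_undup mem_cat eJ ?orbT.
by move=> [GJ GK] e; rewrite mem_undup mem_cat => /orP[/GJ|/GK].
Qed.

Local Notation graphT := (g_sigma_algebraType edge_events).

Lemma measurable_adj (i j : 'I_n) :
  measurable ([set G | adj G i j] : set graphT).
Proof.
wlog : i j / (i < j)%N => [wlt|ij]; last first.
  apply: sub_sigma_algebra; exists [:: (i, j)].
    by split => // e; rewrite inE => /eqP ->.
  apply/seteqP; split => G /=.
    by move=> /(_ (i, j)); apply; rewrite inE.
  by move=> Gij e; rewrite inE => /eqP ->.
have [ij|ji|/val_inj ->] := ssrnat.ltngtP i j; first exact: wlt.
  rewrite (_ : [set G | _] = [set G : graphT | adj G j i]); first exact: wlt.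
  by apply/seteqP; split => G /=; rewrite adj_sym.
rewrite (_ : [set G | _] = set0); first exact: measurable0.
by apply/seteqP; split => G //=; rewrite adj_irrefl.
Qed.

Lemma measurable_graph_iso (H : sgraph 'I_n) :
  measurable ([set G | graph_iso G H] : set graphT).
Proof.
rewrite (_ : [set G | _] = \bigcup_(s in [set: {perm 'I_n}])
    \bigcap_(e in [set: 'I_n * 'I_n])
      [set G : graphT | adj G e.1 e.2 = adj H (s e.1) (s e.2)]); last first.
  apply/seteqP; split => G /=.
    move=> [f bf fE]; exists (perm (bij_inj bf)) => // -[i j] _ /=.
    by rewrite !permE.
  move=> [s _ sE]; exists s; first exact: (injF_bij (@perm_inj _ s)).
  by move=> i j; exact: (sE (i, j)).
apply: fin_bigcup_measurable => [|s _]; first exact: finite_finset.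
apply: fin_bigcap_measurable => [|e _]; first exact: finite_finset.
case: (adj H _ _); first exact: measurable_adj.
rewrite (_ : [set G | _] = ~` [set G : graphT | adj G e.1 e.2]).
  by apply: measurableC; exact: measurable_adj.
by apply/seteqP; split => G /=; case: (adj G _ _).
Qed.

Lemma measurable_to_graph d (T : measurableType d) (G : T -> sgraph 'I_n)
    (E : set (sgraph 'I_n)) :
  random_graph G -> <<s edge_events >> E -> measurable (G @^-1` E).
Proof.
move=> mG; suff: measurable_fun setT (G : T -> graphT).
  by move=> + sE => /(_ measurableT E sE); rewrite setTI.
apply: (@measurability _ _ T graphT _ _ edge_events) => //.
move=> _ [_ [J [uJ ltJ] <-] <-]; rewrite setTI.
rewrite (_ : _ @^-1` _ =
  \bigcap_(e in [set` J]) [set w | adj (G w) e.1 e.2]) //.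
by apply: fin_bigcap_measurable => // e _; exact: mG.
Qed.

End edge_events.

Section relabelling.
Variable n : nat.

Definition relabel (s : {perm 'I_n}) (G : sgraph 'I_n) : sgraph 'I_n :=
  @SGraph 'I_n (fun i j => adj G (s i) (s j))
    (fun i j => adj_sym G (s i) (s j)) (fun i => adj_irrefl G (s i)).

Lemma graph_iso_relabel (s : {perm 'I_n}) (G H : sgraph 'I_n) :
  graph_iso (relabel s G) H <-> graph_iso G H.
Proof.
have bs (u : {perm 'I_n}) : bijective u by exact: (injF_bij (@perm_inj _ u)).
split => -[f bf fE].
  exists (f \o (s^-1)%g); first exact: bij_comp.
  by move=> i j; rewrite /= -fE /= !permKV.
by exists (f \o s); [exact: bij_comp|move=> i j; exact: fE].
Qed.

End relabelling.

(** * Independence of marks and arrival times *)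

Definition increasing_times (R : realType) (n : nat) : set ('I_n -> I01 R) :=
  [set t | forall i j : 'I_n, (i < j)%N -> val01 (t i) < val01 (t j)].

Lemma measurable_increasing_times (R : realType) (n : nat) :
  measurable (@increasing_times R n :
    set (g_sigma_algebraType (@rectangles 'I_n _ (I01 R)))).
Proof.
rewrite (_ : @increasing_times R n =
  \bigcap_(e in [set e : 'I_n * 'I_n | (e.1 < e.2)%N])
    [set t : 'I_n -> I01 R | val01 (t e.1) < val01 (t e.2)]); last first.
  apply/seteqP; split => t /= tlt; first by move=> e ij; exact: tlt.
  by move=> i j ij; exact: (tlt (i, j)).
apply: fin_bigcap_measurable => [|e _]; first exact: finite_finset.
have mval i : measurable_fun setT (fun t : g_sigma_algebraType
    (@rectangles 'I_n _ (I01 R)) => val01 (t i)).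
  exact: (measurableT_comp (@measurable_val01 R)
    (@measurable_coordinate 'I_n _ (I01 R) i)).
have := measurable_fun_ltr (mval e.1) (mval e.2).
by move=> /(_ measurableT [set true] Logic.I); rewrite setTI.
Qed.

Section two_models.
Context (R : realType) (nu : probability (I01 R) R) (n : nat).
Context d (T : measurableType d) (P : probability T R).
Variables (theta : nat -> {RV P >-> I01 R}) (Ginf : T -> sgraph nat).
Hypothesis hGinf : is_G_infty P nu theta Ginf.
Context d' (T' : measurableType d') (P' : probability T' R).

Local Notation markT := (g_sigma_algebraType (@rectangles 'I_n _ (I01 R))).

Section marks.
Variable X : 'I_n -> {RV P' >-> (I01 R * I01 R)%type}.
Hypothesis iidX : iid_with_law P' (mu_nu nu) X.

Let s (w : T') : markT := fun i => (X i w).1.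
Let t (w : T') : markT := fun i => (X i w).2.
Let th (w : T) : markT := fun i => theta i w.

Lemma measurable_marks : measurable_fun setT s.
Proof.
apply: measurable_to_product => i.
exact: (measurableT_comp measurable_fst).
Qed.

Lemma measurable_times : measurable_fun setT t.
Proof.
apply: measurable_to_product => i.
exact: (measurableT_comp measurable_snd).
Qed.

Lemma measurable_labels : measurable_fun setT th.
Proof. by apply: measurable_to_product => i. Qed.

Lemma marks_times_rectangle (B C : 'I_n -> set (I01 R)) :
  (forall i, measurable (B i)) -> (forall i, measurable (C i)) ->
  P' [set w | forall i, B i (X i w).1 /\ C i (X i w).2] =
  (\prod_i (nu (B i) * lebesgue01 (C i)))%E.
Proof.
move=> mB mC; have := iid_rectangle (B := fun i => B i `*` C i) iidX.
move=> -> => [|i]; last exact: measurableX.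
by apply: eq_bigr => i _; exact: product_measure1E.
Qed.

Lemma marks_rectangle (B : 'I_n -> set (I01 R)) :
  (forall i, measurable (B i)) ->
  P' (s @^-1` [set x | forall i, B i (x i)]) = (\prod_i nu (B i))%E.
Proof.
move=> mB; have := marks_times_rectangle mB (fun=> measurableT).
under eq_bigr do rewrite probability_setT mule1.
move=> <-; congr (P' _).
by apply/seteqP; split => w /= H i; [split => //; exact: H|case: (H i)].
Qed.

Lemma times_rectangle (C : 'I_n -> set (I01 R)) :
  (forall i, measurable (C i)) ->
  P' (t @^-1` [set x | forall i, C i (x i)]) = (\prod_i lebesgue01 (C i))%E.
Proof.
move=> mC; have := marks_times_rectangle (fun=> measurableT) mC.
under eq_bigr do rewrite probability_setT mul1e.
move=> <-; congr (P' _).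
by apply/seteqP; split => w /= H i; [split => //; exact: H|case: (H i)].
Qed.

(** Independence of the points X_i only gives this on products of rectangles. It
    extends to all A with the rectangle of marks fixed, and then to all B with A
    fixed. The second extension also moves from the marks to the labels theta,
    which have the same law on rectangles. *)
Lemma marks_independent_of_times (A B : set markT) :
  measurable A -> measurable B ->
  P' (s @^-1` B `&` t @^-1` A) = (P (th @^-1` B) * P' (t @^-1` A))%E.
Proof.
move=> mA.
have pre d1 (T1 : measurableType d1) (f : T1 -> markT) (D : set markT) :
    measurable_fun setT f -> measurable D -> measurable (f @^-1` D).
  by move=> mf mD; rewrite -[X in measurable X]setTI; exact: mf.
have sub (D : set markT) : rectangles D -> measurable D.
  by move=> rD; exact: sub_sigma_algebra.
have times_given_marks (B0 : set markT) : rectangles B0 ->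
    P' (t @^-1` A `&` s @^-1` B0) = (P' (t @^-1` A) * P' (s @^-1` B0))%E.
  move=> rB; apply: (law_given_event_unique (@rectangles_setI _ _ _)) mA.
  - by apply: pre; [exact: measurable_marks|exact: sub].
  - by move=> C rC; apply: pre; [exact: measurable_times|exact: sub].
  - by move=> C rC; apply: pre; [exact: measurable_times|exact: sub].
  - move: rB => [B' mB' <-] _ [C mC <-].
    rewrite marks_rectangle// times_rectangle// muleC -big_split/=.
    rewrite -marks_times_rectangle//; congr (P' _).
    apply/seteqP; split => w /=; first by move=> [tC sB] i.
    by move=> H; split => i; case: (H i).
apply: (law_given_event_unique (@rectangles_setI _ _ _)).
- by apply: pre; first exact: measurable_times.
- by move=> C rC; apply: pre; [exact: measurable_labels|exact: sub].
- by move=> C rC; apply: pre; [exact: measurable_marks|exact: sub].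
- move=> C rC; rewrite setIC times_given_marks// muleC; congr (_ * _)%E.
  case: rC => C' mC' <-; rewrite marks_rectangle//.
  have [iidth _ _] := hGinf.
  exact/esym/(iid_rectangle (iid_reindex (@ord_inj n) iidth) mC').
Qed.

End marks.
End two_models.

(** * The kernel graph when the times increase with the vertex *)

(** Conditional probabilities given the points X_i may thus be integrated over
    this event. *)
Lemma sigma_family_increasing_times (R : realType) (n : nat)
    d (T : measurableType d) (X : 'I_n -> T -> (I01 R * I01 R)%type) :
  sigma_family X ((fun w i => (X i w).2) @^-1` @increasing_times R n).
Proof.
set gens := [set A | exists i (B : set (I01 R * I01 R)),
  measurable B /\ A = X i @^-1` B].
have mX i : measurable_fun setT (X i : g_sigma_algebraType gens -> _).
  by move=> _ B mB; rewrite setTI; apply: sub_sigma_algebra; exists i, B.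
have mt : @measurable_fun _ _ (g_sigma_algebraType gens)
    (g_sigma_algebraType (@rectangles 'I_n _ (I01 R))) setT
    (fun w i => (X i w).2).
  apply: measurable_to_product => i.
  exact: (measurableT_comp measurable_snd).
by have := mt measurableT _ (@measurable_increasing_times R n); rewrite setTI.
Qed.

Section ordered_times.
Context (R : realType) (nu : probability (I01 R) R) (n : nat).
Context d (T : measurableType d) (P : probability T R).
Variables (theta : nat -> {RV P >-> I01 R}) (Ginf : T -> sgraph nat).
Hypothesis hGinf : is_G_infty P nu theta Ginf.
Context d' (T' : measurableType d') (P' : probability T' R).
Variables (X : 'I_n -> {RV P' >-> (I01 R * I01 R)%type}).
Variable (GW : T' -> sgraph 'I_n).
Hypothesis hGW : is_G_kernel P' (mu_nu nu) (later_kernel R) X GW.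

Local Notation increasing :=
  ((fun w i => (X i w).2) @^-1` @increasing_times R n).

Lemma measurable_increasing : measurable increasing.
Proof.
have := measurable_times X measurableT (@measurable_increasing_times R n).
by rewrite setTI.
Qed.

Lemma random_initial_subgraph :
  random_graph (fun w => initial_subgraph n (Ginf w)).
Proof. by move=> i j; have [_ + _] := hGinf; exact. Qed.

Lemma initial_subgraph_edges (J : seq ('I_n * 'I_n)) : uniq J ->
    (forall e, e \in J -> (e.1 < e.2)%N) ->
  P [set w | forall e, e \in J -> adj (initial_subgraph n (Ginf w)) e.1 e.2] =
  (\int[P]_w (\prod_(e <- J) val01 (theta e.2 w))%:E)%E.
Proof.
move=> uJ ltJ; pose v (e : 'I_n * 'I_n) : nat * nat := (val e.1, val e.2).
have v_inj : injective v by move=> [i j] [k l] [/val_inj -> /val_inj ->].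
have [_ _ condG] := hGinf.
have [] := condG (map v J); first by rewrite map_inj_uniq.
  by move=> _ /mapP[e eJ ->]; exact: ltJ.
move=> _ _ /(_ setT).
have -> : (\int[P]_(w in setT)
    (\prod_(e <- map v J) val01 (theta (maxn e.1 e.2) w))%:E =
    \int[P]_w (\prod_(e <- J) val01 (theta e.2 w))%:E)%E.
  apply: eq_integral => w _; rewrite big_map; congr (_%:E).
  apply: eq_big_seq => e eJ /=.
  by rewrite (maxn_idPr _)//; exact/ltnW/ltJ.
move=> <-.
  rewrite setIT; congr (P _); apply/seteqP; split => w /= H.
    by move=> _ /mapP[e eJ ->]; exact: H.
  by move=> e eJ; exact/(H (v e))/map_f.
exact: (@measurableT _ (g_sigma_algebraType _)).
Qed.

(** When the times increase, e.2 is the later endpoint of every edge e of J, so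
    the kernel returns its mark. *)
Lemma kernel_edges_increasing (J : seq ('I_n * 'I_n)) : uniq J ->
    (forall e, e \in J -> (e.1 < e.2)%N) ->
  P' ([set w | forall e, e \in J -> adj (GW w) e.1 e.2] `&` increasing) =
  (\int[P']_(w in increasing) (\prod_(e <- J) val01 (X e.2 w).1)%:E)%E.
Proof.
move=> uJ ltJ; have [_ _ condG] := hGW.
have [] := condG J uJ ltJ.
move=> _ _ /(_ _ (@sigma_family_increasing_times R n _ T' X)) ->.
apply: eq_integral => w /[!inE] /= incw; congr (_%:E).
apply: eq_big_seq => e eJ.
have := incw _ _ (ltJ _ eJ).
by case: (X e.1 w) => s1 t1; case: (X e.2 w) => s2 t2 /= ->.
Qed.

(** Both probabilities are integrals of the same product over J, of the marks in
    one model and of the labels theta in the other. *)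
Lemma edges_given_increasing (J : seq ('I_n * 'I_n)) : uniq J ->
    (forall e, e \in J -> (e.1 < e.2)%N) ->
  P' ([set w | forall e, e \in J -> adj (GW w) e.1 e.2] `&` increasing) =
  (P [set w | forall e, e \in J -> adj (initial_subgraph n (Ginf w)) e.1 e.2]
   * P' increasing)%E.
Proof.
move=> uJ ltJ; have [iidX _ _] := hGW.
rewrite kernel_edges_increasing// initial_subgraph_edges//.
pose V := g_sigma_algebraType (@rectangles 'I_n _ (I01 R)).
apply: (@integral_given_event _ _ _ _ _ _ _ _ V
  (fun w i => theta i w) (fun w i => (X i w).1) increasing
  (fun x : V => \prod_(e <- J) val01 (x e.2))).
- exact: measurable_labels.
- exact: measurable_marks.
- exact: measurable_increasing.
- apply: measurable_prod => e _.
  exact: (measurableT_comp (@measurable_val01 R)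
    (@measurable_coordinate 'I_n _ (I01 R) e.2)).
- by move=> x; apply: prodr_ge0 => e _; rewrite /val01 ge0.
- move=> B mB; apply: (marks_independent_of_times hGinf iidX) => //.
  exact: measurable_increasing_times.
Qed.

Lemma graph_iso_given_increasing (H : sgraph 'I_n) :
  P' ([set w | graph_iso (GW w) H] `&` increasing) =
  (P [set w | graph_iso (initial_subgraph n (Ginf w)) H] * P' increasing)%E.
Proof.
have [_ rGW _] := hGW.
apply: (law_given_event_unique (@edge_events_setI n)) (measurable_graph_iso H).
- exact: measurable_increasing.
- move=> E GE; apply: measurable_to_graph random_initial_subgraph _.
  exact: sub_sigma_algebra.
- by move=> E GE; apply: (measurable_to_graph rGW); exact: sub_sigma_algebra.
- by move=> _ [J [uJ ltJ] <-]; exact: edges_given_increasing.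
Qed.

End ordered_times.

(** * Summing over the order of arrival *)

Section ordering_permutation.
Context (R : realType) (n : nat).
Implicit Types (t : 'I_n -> I01 R) (s : {perm 'I_n}).

(** The number of earlier arrivals. The permutation that lists the vertices in
    order of arrival can only be the inverse of this map, which gives both its
    uniqueness and its existence. *)
Definition time_rank t (i : 'I_n) : nat :=
  #|[set j | val01 (t j) < val01 (t i)]|%SET.

Lemma time_rank_increasing t s : increasing_times (fun i => t (s i)) ->
  forall i, time_rank t (s i) = i.
Proof.
move=> ts i; rewrite /time_rank.
have -> : [set j | val01 (t j) < val01 (t (s i))]%SET =
    [set s k | k in [set k : 'I_n | (k < i)%N]%SET]%SET.
  apply/setP => j; rewrite inE; apply/idP/imsetP => [tj|[k]]; last first.
    by rewrite inE => ki ->; exact: ts.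
  exists ((s^-1)%g j); last by rewrite permKV.
  rewrite inE ltnNge leq_eqVlt; apply/negP => /orP[/eqP/val_inj ij|ij].
    by move: tj; rewrite ij permKV ltxx.
  by have := ts _ _ ij; rewrite permKV ltNge (ltW tj).
rewrite card_imset; last exact: perm_inj.
rewrite cardsE -sum1_card (big_ord_narrow (ltnW (ltn_ord i))).
by rewrite sum1_card card_ord.
Qed.

Lemma increasing_perm_uniq t s s' : increasing_times (fun i => t (s i)) ->
  increasing_times (fun i => t (s' i)) -> s = s'.
Proof.
move=> ts ts'; suff ss' i : s (((s^-1)%g : {perm 'I_n}) i) = s' ((s^-1)%g i).
  by apply/permP => i; have := ss' (s i); rewrite !permK.
rewrite permKV; have := time_rank_increasing ts ((s^-1)%g i); rewrite permKV.
have := time_rank_increasing ts' ((s'^-1)%g i).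
rewrite permKV => -> /val_inj <-.
by rewrite permKV.
Qed.

Lemma increasing_perm_exists t : injective (fun i => val01 (t i)) ->
  exists s, increasing_times (fun i => t (s i)).
Proof.
move=> t_inj.
have rank_mono i j :
    val01 (t i) < val01 (t j) -> (time_rank t i < time_rank t j)%N.
  move=> tij; apply: proper_card; apply/properP; split.
    by apply/fintype.subsetP => k; rewrite !inE => /lt_trans; apply.
  by exists i; rewrite inE ?ltxx.
have rank_lt i : (time_rank t i < n)%N.
  rewrite -[ltnRHS]card_ord; apply: proper_card; apply/properP; split.
    exact: subset_predT.
  by exists i; rewrite // inE ltxx.
have r_inj : injective (fun i => Ordinal (rank_lt i)).
  move=> i j [rij]; apply: t_inj.
  by have [/rank_mono|/rank_mono|//] := ltgtP (val01 (t i)) (val01 (t j));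
    rewrite rij ltnn.
pose r := perm r_inj; exists (r^-1)%g => i j ij.
have rE k : time_rank t ((r^-1)%g k) = k.
  by have := congr1 val (permKV r k); rewrite {1}/r permE.
rewrite ltNge le_eqVlt; apply/negP => /orP[/eqP/t_inj/perm_inj ji|/rank_mono].
  by rewrite ji ltnn in ij.
by rewrite !rE ltnNge (ltnW ij).
Qed.

End ordering_permutation.

Section time_orders.
Context (R : realType) (nu : probability (I01 R) R) (n : nat).
Context d (T : measurableType d) (P : probability T R).
Variable X : 'I_n -> {RV P >-> (I01 R * I01 R)%type}.
Hypothesis iidX : iid_with_law P (mu_nu nu) X.

Lemma measurable_time (i : 'I_n) : measurable_fun setT (fun w => (X i w).2).
Proof. exact: (measurableT_comp measurable_snd). Qed.

Lemma lebesgue01_set1 (x : I01 R) : lebesgue01 [set x] = 0%E.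
Proof. by rewrite /lebesgue01 image_set1 lebesgue_measure_set1. Qed.

Lemma measurable_diagonal : measurable [set z : I01 R * I01 R | z.1 = z.2].
Proof.
have m1 : measurable_fun setT (fun z : I01 R * I01 R => val01 z.1).
  exact: (measurableT_comp (@measurable_val01 R) measurable_fst).
have m2 : measurable_fun setT (fun z : I01 R * I01 R => val01 z.2).
  exact: (measurableT_comp (@measurable_val01 R) measurable_snd).
have := measurable_fun_eqr m1 m2 measurableT (Y := [set true]) Logic.I.
rewrite setTI; congr (measurable _).
by apply/seteqP; split => z /=; [move/eqP/val_inj|move=> ->; exact: eqxx].
Qed.

(** The pair of times is uniform on the unit square, whose diagonal has null
    sections. *)
Lemma simultaneous_times_null (i j : 'I_n) : i != j ->
  P [set w | (X i w).2 = (X j w).2] = 0%E.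
Proof.
move=> ij.
have mp : measurable_fun setT (fun w => ((X i w).2, (X j w).2)).
  by apply: measurable_fun_pair; exact: measurable_time.
pose tt : {mfun T >-> (I01 R * I01 R)%type} :=
  HB.pack (fun w => ((X i w).2, (X j w).2))
    (isMeasurableFun.Build _ _ _ _ _ mp).
rewrite -[LHS]/(distribution P tt [set z : I01 R * I01 R | z.1 = z.2]).
rewrite -(@product_measure_unique _ _ _ _ R (lebesgue01 (R := R))
  (lebesgue01 (R := R))); last 2 first.
- move=> B C mB mC; have [indX lawX] := iidX.
  pose D k : set (I01 R * I01 R) := setT `*` (if k == i then B else C).
  have := indX [:: i; j] D; rewrite /= inE ij => /(_ erefl).
  rewrite big_cons big_seq1 /D eqxx eq_sym (negbTE ij).
  have lawE k (E : set (I01 R)) : measurable E ->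
      P (X k @^-1` (setT `*` E)) = lebesgue01 E.
    move=> mE; rewrite [LHS](lawX k _ (measurableX measurableT mE)).
    transitivity (nu setT * lebesgue01 E)%E; first exact: product_measure1E.
    by rewrite probability_setT mul1e.
  rewrite !lawE// => <-; last first.
    by move=> k _; apply: measurableX => //; case: ifP.
  congr (P _); apply/seteqP; split => w /=.
    move=> [wB wC] k; rewrite !inE => /orP[]/eqP ->; split => //.
      by rewrite eqxx.
    by rewrite eq_sym (negbTE ij).
  move=> H; split.
    by have := (H i); rewrite !inE !eqxx => /(_ erefl)[].
  by have := (H j); rewrite !inE eqxx orbT eq_sym (negbTE ij) => /(_ erefl)[].
- exact: measurable_diagonal.
rewrite /product_measure1 /=; apply: integral0_eq => x _ /=.
rewrite (_ : xsection _ x = [set x]) ?lebesgue01_set1//.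
by apply/seteqP; split => y; rewrite /xsection /= inE.
Qed.

(** The summands are the probabilities of E on disjoint events. Outside their
    union two times coincide. *)
Lemma sum_over_time_orders (E : set T) : measurable E ->
  P E = (\sum_(s \in [set: {perm 'I_n}])
    P (E `&` (fun w i => (X (s i) w).2) @^-1` @increasing_times R n))%E.
Proof.
move=> mE; pose A (s : {perm 'I_n}) :=
  (fun w i => (X (s i) w).2) @^-1` @increasing_times R n.
have mA s : measurable (A s).
  exact: (measurable_increasing (fun i => X (s i))).
pose U := \bigcup_(s in [set: {perm 'I_n}]) A s.
have mU : measurable U.
  by apply: fin_bigcup_measurable => //; exact: finite_finset.
have nullC : P (E `\` U) = 0%E.
  (* The pairs of vertices are enumerated by natural numbers, so that the null
     events where their times coincide form a sequence. *)
  pose N k := if unpickle k is Some e then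
    [set w | (e : 'I_n * 'I_n).1 != e.2 /\ (X e.1 w).2 = (X e.2 w).2] else set0.
  apply/negligibleP; first exact: measurableD.
  apply: (@negligibleS _ _ _ P (\bigcup_k N k)).
    move=> w [_ /= nUw]; apply: contrapT => nNw; apply: nUw.
    have [|s ws] := @increasing_perm_exists R n (fun i => (X i w).2).
      move=> i j /val_inj tij; apply/eqP/negPn/negP => ij; apply: nNw.
      by exists (pickle (i, j)) => //; rewrite /N pickleK.
    by exists s.
  apply: negligible_bigcup => k; rewrite /N.
  case: (unpickle k) => [[i j]|]; last exact: negligible_set0.
  have [->|ij] := eqVneq i j.
    rewrite (_ : [set w | _] = set0) -?subset0 => [|w []//].
    exact: negligible_set0.
  apply: (@negligibleS _ _ _ P [set w | (X i w).2 = (X j w).2]).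
    by move=> w [].
  apply/negligibleP; last exact: simultaneous_times_null.
  have := measurable_fun_pair (measurable_time i) (measurable_time j).
  by move=> /(_ measurableT _ measurable_diagonal); rewrite setTI.
rewrite (measureDI P mE mU) [X in (X + _)%E]nullC add0e.
rewrite setI_bigcupr measure_fin_bigcup//.
- exact: finite_finset.
- move=> s s' _ _ [w [[_ As] [_ As']]].
  exact: (@increasing_perm_uniq R n (fun i => (X i w).2)).
- by move=> s _; exact: measurableI.
Qed.

End time_orders.

(** * Relabelling the kernel graph *)

Lemma sigma_family_perm (I : finType) d (S : measurableType d)
    d' (T : measurableType d') (X : I -> T -> S) (s : {perm I}) :
  sigma_family (fun i => X (s i)) = sigma_family X.
Proof.
congr (<<s _ >>); apply/seteqP; split => A /= [i [B [mB ->]]].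
  by exists (s i), B.
by exists ((s^-1)%g i), B; rewrite permKV.
Qed.

(** The points are i.i.d. and the kernel is symmetric, so the model does not
    distinguish any numbering of the vertices. *)
Lemma is_G_kernel_relabel (R : realType) d (T : measurableType d)
    (P : probability T R) d' (S : measurableType d') (mu : probability S R)
    (W : graph_kernel R S) (n : nat) (X : 'I_n -> {RV P >-> S})
    (G : T -> sgraph 'I_n) (s : {perm 'I_n}) :
  is_G_kernel P mu W X G ->
  is_G_kernel P mu W (fun i => X (s i)) (fun w => relabel s (G w)).
Proof.
move=> [iidX rG condG]; split.
- exact: (iid_reindex (@perm_inj _ s) iidX).
- by move=> i j; exact: rG.
move=> J uJ ltJ.
(* The image of an edge under s may have its endpoints in the wrong order; v
   puts them back in increasing order, which changes neither adjacency nor the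
   value of the symmetric kernel. *)
pose v (e : 'I_n * 'I_n) :=
  if (s e.1 < s e.2)%N then (s e.1, s e.2) else (s e.2, s e.1).
have v_inj : {in J &, injective v}.
  move=> [i j] [k l] /ltJ /= ij /ltJ /= kl; rewrite /v /=.
  have sneq (a b : 'I_n) : (a < b)%O -> ~ (b < a)%O by move=> /lt_gtF ->.
  case: ifP => _; case: ifP => _ [] /perm_inj e1 /perm_inj e2;
    rewrite ?e1 ?e2 // in ij *; by case: (sneq _ _ kl ij).
have adjv H e : adj (relabel s H) e.1 e.2 = adj H (v e).1 (v e).2.
  by rewrite /v; case: ifP => //= _; rewrite adj_sym.
have := condG (map v J); rewrite map_inj_in_uniq// => /(_ uJ).
have ltvJ e : e \in map v J -> (e.1 < e.2)%O.
  move=> /mapP[[i j] /ltJ /= ij ->]; rewrite /v /=; case: ifP => //= /negbT.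
  rewrite -leqNgt leq_eqVlt => /orP[/eqP/val_inj/perm_inj ji|//].
  by rewrite ji ltxx in ij.
move=> /(_ ltvJ); congr cond_prob_version.
- exact/esym/(sigma_family_perm (fun i => X i : T -> S)).
- apply/seteqP; split => w /= H.
    by move=> e eJ; have := H _ (map_f v eJ); rewrite -adjv.
  by move=> _ /mapP[e eJ ->]; rewrite -adjv; exact: H.
- apply/funext => w; rewrite big_map; apply: eq_bigr => e _.
  by rewrite /v; case: ifP => //= _; rewrite kernel_sym.
Qed.

Theorem theorem5p1 (R : realType) (nu : probability (I01 R) R)
    (n : nat) (hn : (1 <= n)%N)
    (d : measure_display) (T : measurableType d) (P : probability T R)
    (theta : nat -> {RV P >-> I01 R}) (Ginf : T -> sgraph nat)
    (hGinf : is_G_infty P nu theta Ginf)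
    (d' : measure_display) (T' : measurableType d') (P' : probability T' R)
    (X : 'I_n -> {RV P' >-> (I01 R * I01 R)%type}) (GW : T' -> sgraph 'I_n)
    (hGW : is_G_kernel P' (mu_nu nu) (later_kernel R) X GW) :
  same_unlabelled_law P P' (fun w => initial_subgraph n (Ginf w)) GW.
Proof.
move=> H; have [iidX rGW _] := hGW.
have mE : measurable [set w | graph_iso (GW w) H].
  exact: (measurable_to_graph rGW (measurable_graph_iso H)).
rewrite [RHS](sum_over_time_orders iidX mE).
pose A (s : {perm 'I_n}) :=
  (fun w i => (X (s i) w).2) @^-1` @increasing_times R n.
set p := P _.
(* The case E = setT of the same decomposition: the P' (A s) add up to 1. *)
transitivity (\sum_(s \in [set: {perm 'I_n}]) (p * P' (A s)))%E.
  rewrite -ge0_mule_fsumr//.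
  have := sum_over_time_orders iidX measurableT.
  rewrite probability_setT; under eq_fsbigr do rewrite setTI.
  by move=> <-; rewrite mule1.
apply: eq_fsbigr => s _.
have := graph_iso_given_increasing hGinf (is_G_kernel_relabel s hGW) H.
move=> <-; congr (P' (_ `&` _)).
by apply/seteqP; split => w /=; rewrite graph_iso_relabel.
Qed.
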